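(* We have $\mathfrak{M}_{\mathrm{CL}}=\mathfrak{M}_{\mathrm{PCL}}$, and this poset is isomorphic to the set of all downsets of $\mathrm{M}_{\mathrm{PCL}}$ ordered by inclusion. Moreover, $\mathrm{M}_{\mathrm{CL}}$ is isomorphic to the set of all finitely generated downsets of $\mathrm{M}_{\mathrm{PCL}}$ ordered by inclusion.
   Context: A clone is a set of operations of arity $\geq1$ on a fixed nonempty set that contains all projections and is closed under composition. A height 1 identity is an identity $f(x_{\sigma(1)},\dots,x_{\sigma(n)})\approx g(x_{\tau(1)},\dots,x_{\tau(m)})$ with function symbols $f,g$ and $\sigma\colon[n]\to[r]$, $\tau\colon[m]\to[r]$. A clone satisfies a set $\Sigma$ of height 1 identities if its function symbols can be interpreted by operations of the clone (of the right arity) so that all identities in $\Sigma$ hold for all values of the variables. $\Sigma\Rightarrow\Gamma$ means that every clone satisfying $\Sigma$ satisfies $\Gamma$; $\Sigma\Leftrightarrow\Gamma$ means both implications hold, and $[\Sigma]$ denotes the class of all sets of height 1 identities equivalent to $\Sigma$. A loop condition is a height 1 identity $f(x_{\sigma(1)},\dots,x_{\sigma(m)})\approx f(x_{\tau(1)},\dots,x_{\tau(m)})$, $\sigma,\tau\colon[m]\to[n]$; it is a cyclic loop condition if the digraph $([n],\{(\sigma(i),\tau(i))\mid i\in[m]\})$ is a finite nonempty disjoint union of directed cycles. For a finite nonempty $C\subset\mathbb{N}^+$ let $V_C=\{(a,k)\mid a\in C,k\in\mathbb{Z}_a\}$, $\sigma_C\colon(a,k)\mapsto(a,k+1)$; $\Sigma_C$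 is the cyclic loop condition $f\approx f_{\sigma_C}$ (that is, $f\colon A^{V_C}\to A$ with $f(t)=f(t\circ\sigma_C)$ for all $t\in A^{V_C}$). Every cyclic loop condition is equivalent to $\Sigma_C$ with $C$ the set of lengths of cycles of its digraph. $\Sigma_P$ is a prime cyclic loop condition if $P$ is a finite nonempty set of primes. In a set of loop conditions, different members use different function symbols, so a clone satisfies the set iff it satisfies each member. The posets: $\mathrm{M}_{\mathrm{CL}}$ consists of the classes $[\Sigma]$ for $\Sigma$ a cyclic loop condition; $\mathrm{M}_{\mathrm{PCL}}$ of the classes $[\Sigma]$ for $\Sigma$ a prime cyclic loop condition; $\mathfrak{M}_{\mathrm{CL}}$ of the classes $[\Sigma]$ for $\Sigma$ a (finite or infinite, possibly empty) set of cyclic loop conditions; $\mathfrak{M}_{\mathrm{PCL}}$ of the classes $[\Sigma]$ for $\Sigma$ a set of prime cyclic loop conditions. All are ordered by $\Leftarrow$: $[\Sigma]\leq[\Gamma]$ iff $\Gamma\Rightarrow\Sigma$ (weaker conditions are smaller). Downsets may be empty, and a finitely generated downset is the downward closure of a finite (possibly empty) set. *)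

(* Defs.v *)
From mathcomp Require Import all_boot finmap.
From mathcomp Require Import boolp classical_sets.

Set Implicit Arguments.
Unset Strict Implicit.
Unset Printing Implicit Defensive.

Local Open Scope classical_set_scope.

(** * Clones *)

Definition operation (A : Type) (n : nat) := ('I_n -> A) -> A.

Record clone := Clone {
  carrier :> Type;
  carrier_inhabited : inhabited carrier;
  clone_op : forall n, set (operation carrier n);
  clone_arity : forall n (f : operation carrier n), clone_op f -> 0 < n;
  clone_proj : forall n (i : 'I_n), clone_op (fun x : 'I_n -> carrier => x i);
  clone_comp : forall n m (f : operation carrier n)
      (g : 'I_n -> operation carrier m),
    clone_op f -> (forall i, clone_op (g i)) ->
    clone_op (fun x => f (fun i => g i x)) }.

(** * Sets of height 1 identities *)

Record signature := Signature {
  symbol :> Type;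
  arity : symbol -> nat;
  arity_gt0 : forall s, 0 < arity s }.

Record h1_identity (S : signature) := H1Identity {
  nvars : nat;
  lhs_symbol : S;
  rhs_symbol : S;
  lhs_map : 'I_(arity lhs_symbol) -> 'I_nvars;
  rhs_map : 'I_(arity rhs_symbol) -> 'I_nvars }.

Record h1_set := H1Set {
  h1_signature : signature;
  h1_identities : set (h1_identity h1_signature) }.

Definition interpretation (S : signature) (C : clone) :=
  forall s : S, operation C (arity s).

Definition holds (S : signature) (C : clone) (I : interpretation S C)
    (e : h1_identity S) : Prop :=
  forall x : 'I_(nvars e) -> C,
    I (lhs_symbol e) (x \o lhs_map (h:=e)) =
    I (rhs_symbol e) (x \o rhs_map (h:=e)).

Definition satisfies (C : clone) (Sigma : h1_set) : Prop :=
  exists I : interpretation (h1_signature Sigma) C,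
    (forall s, clone_op (I s)) /\
    (forall e, h1_identities e -> holds I e).

Definition h1_implies (Sigma Gamma : h1_set) : Prop :=
  forall C : clone, satisfies C Sigma -> satisfies C Gamma.

Definition h1_equiv (Sigma Gamma : h1_set) : Prop :=
  h1_implies Sigma Gamma /\ h1_implies Gamma Sigma.

(** Collections of [h1_set]s are plain predicates: [h1_set] quantifies over
    all types of symbols and is too large for the universe of [set]. *)
Definition h1_class (Sigma : h1_set) : h1_set -> Prop :=
  fun Gamma => h1_equiv Sigma Gamma.

Definition class_le (X Y : h1_set -> Prop) : Prop :=
  exists Sigma Gamma,
    [/\ X = h1_class Sigma, Y = h1_class Gamma & h1_implies Gamma Sigma].

Lemma h1_class_eq Sigma Gamma :
  h1_class Sigma = h1_class Gamma <-> h1_equiv Sigma Gamma.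
Proof.
split=> [E|[SG GS]].
  suff : h1_class Sigma Gamma by [].
  by rewrite E; split.
apply: functional_extensionality_dep => D; apply: propositional_extensionality.
by split=> -[SD DS]; split=> C ?; auto.
Qed.

Lemma class_leE Sigma Gamma :
  class_le (h1_class Sigma) (h1_class Gamma) <-> h1_implies Gamma Sigma.
Proof.
split=> [[S [G [/h1_class_eq[_ SS'] /h1_class_eq[G'G _] GS]]]|GS].
  by move=> C /G'G/GS/SS'.
by exists Sigma, Gamma.
Qed.

(** * Loop conditions *)

(** The identity f(x_{σ(1)},…,x_{σ(m)}) ≈ f(x_{τ(1)},…,x_{τ(m)}) with
    σ, τ : [m] → [n]; the name of the symbol f is left out. *)
Record loop_condition := LoopCondition {
  loop_arity : nat;
  loop_nvars : nat;
  loop_arity_gt0 : 0 < loop_arity;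
  loop_src : 'I_loop_arity -> 'I_loop_nvars;
  loop_tgt : 'I_loop_arity -> 'I_loop_nvars }.

(** A set [L] of loop conditions as a set of height 1 identities: the members
    of [L] themselves serve as function symbols, so that different members use
    different symbols. *)
Definition loop_signature (L : set loop_condition) : signature :=
  @Signature {l | L l} (fun l => loop_arity (sval l))
    (fun l => loop_arity_gt0 (sval l)).

Definition loop_identity (L : set loop_condition) (l : loop_signature L) :
    h1_identity (loop_signature L) :=
  @H1Identity (loop_signature L) (loop_nvars (sval l)) l l
    (@loop_src (sval l)) (@loop_tgt (sval l)).

Definition loop_set (L : set loop_condition) : h1_set :=
  H1Set (range (@loop_identity L)).

Definition loop_edge (l : loop_condition) (x y : 'I_(loop_nvars l)) : Prop :=
  exists i, loop_src i = x /\ loop_tgt i = y.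

(** The successor map of the disjoint union of directed cycles of lengths
    [c i]; [ordS] is k ↦ k + 1 modulo [c i]. *)
Definition cycles_succ (I : Type) (c : I -> nat) (u : {i : I & 'I_(c i)}) :
    {i : I & 'I_(c i)} :=
  existT _ (tag u) (ordS (tagged u)).

Definition is_cyclic (l : loop_condition) : Prop :=
  exists (k : nat) (c : 'I_k -> nat)
      (phi : {j : 'I_k & 'I_(c j)} -> 'I_(loop_nvars l)),
    [/\ 0 < k, forall j, 0 < c j, bijective phi &
        forall u v, loop_edge (phi u) (phi v) <-> v = cycles_succ u].

(** Finite nonempty sets of positive integers. *)
Record length_set := LengthSet {
  lengths :> {fset nat};
  lengths_neq0 : lengths != fset0;
  lengths_pos : 0 \notin lengths }.

Definition cycle_vertex (C : length_set) : finType :=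
  {a : lengths C & 'I_(val a)}.

Lemma cycle_vertex_gt0 (C : length_set) : 0 < #|cycle_vertex C|.
Proof.
have /fset0Pn[a aC] := lengths_neq0 C.
have a_gt0 : 0 < a.
  by rewrite lt0n; apply: contraNneq (lengths_pos C) => <-.
apply/card_gt0P.
by exists (existT (fun b : lengths C => 'I_(val b)) [` aC]%fset (Ordinal a_gt0)).
Qed.

(** The condition f(t) = f(t ∘ σ_C), with the index set V_C of the arguments
    and of the variables enumerated as [#|V_C|]. *)
Definition Sigma_ (C : length_set) : loop_condition :=
  LoopCondition (cycle_vertex_gt0 C)
    (fun i : 'I_#|cycle_vertex C| => i)
    (fun i : 'I_#|cycle_vertex C| =>
       enum_rank (cycles_succ (enum_val i) : cycle_vertex C)).

Definition is_prime_cyclic (l : loop_condition) : Prop :=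
  exists P : length_set, (forall p, p \in lengths P -> prime p) /\ l = Sigma_ P.

(** * The posets *)

Definition M_CL : (h1_set -> Prop) -> Prop :=
  fun X => exists2 l, is_cyclic l & X = h1_class (loop_set [set l]).

Definition M_PCL : (h1_set -> Prop) -> Prop :=
  fun X => exists2 l, is_prime_cyclic l & X = h1_class (loop_set [set l]).

Definition frakM_CL : (h1_set -> Prop) -> Prop :=
  fun X => exists2 L : set loop_condition,
    L `<=` is_cyclic & X = h1_class (loop_set L).

Definition frakM_PCL : (h1_set -> Prop) -> Prop :=
  fun X => exists2 L : set loop_condition,
    L `<=` is_prime_cyclic & X = h1_class (loop_set L).

Definition included (T : Type) (D E : T -> Prop) : Prop :=
  forall x, D x -> E x.

Definition is_downset (T : Type) (X : T -> Prop) (le : T -> T -> Prop)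
    (D : T -> Prop) : Prop :=
  included D X /\ forall x y, D x -> X y -> le y x -> D y.

Definition down_closure (T : Type) (X : T -> Prop) (le : T -> T -> Prop)
    (G : T -> Prop) : T -> Prop :=
  fun y => X y /\ exists2 x, G x & le y x.

Definition is_finite (T : Type) (G : T -> Prop) : Prop :=
  exists (k : nat) (g : 'I_k -> T), forall x, G x <-> exists i, x = g i.

Definition is_fg_downset (T : Type) (X : T -> Prop) (le : T -> T -> Prop)
    (D : T -> Prop) : Prop :=
  exists G : T -> Prop,
    [/\ is_finite G, included G X & D = down_closure X le G].

(** An isomorphism between the subset [X] of [T] ordered by [leX] and the
    subset [Y] of [U] ordered by [leY]; values outside [X] are irrelevant. *)
Definition order_isomorphic (T U : Type) (X : T -> Prop) (leX : T -> T -> Prop)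
    (Y : U -> Prop) (leY : U -> U -> Prop) : Prop :=
  exists f : T -> U,
    [/\ forall x, X x -> Y (f x),
        forall x x', X x -> X x' -> f x = f x' -> x = x',
        forall y, Y y -> exists2 x, X x & f x = y &
        forall x x', X x -> X x' -> (leX x x' <-> leY (f x) (f x'))].

(* Main.v *)
Require Import Defs.
From mathcomp Require Import all_boot finmap.
From mathcomp Require Import boolp classical_sets.

(** A clone satisfies Sigma_C iff it has a term operation on the variables V_C
    that is invariant under the rotation sigma_C.

    Separation: let P be a set of primes and let A be the clone of all
    operations on V_P commuting with sigma_P; it never satisfies Sigma_P. If some
    power of sigma_C maps homomorphically to sigma_P, then Sigma_C implies
    Sigma_P; otherwise every t : V_C -> V_P has a stabilizer, under the joint
    action of the two rotations, that fixes a point of V_P, so an equivariant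
    choice on orbits shows that A satisfies Sigma_C. As a single A works for all
    C, a set of cyclic loop conditions implies Sigma_P only if one of its members
    does.

    Decomposition: Sigma_C follows from the Sigma_Q it implies with Q a set of
    prime divisors of N, the product of C: one shows by descent from N that every
    divisor u of N is a period of some term on V_C, using Q = primes (N / u).
    Conversely, Sigma_C and Sigma_D together amount to Sigma_{CD} with
    CD = {cd | c in C, d in D}. Hence X |-> {Y in M_PCL | Y <= X} is the
    isomorphism in both cases. *)

Set Implicit Arguments.
Unset Strict Implicit.
Unset Printing Implicit Defensive.

Local Open Scope classical_set_scope.

(** * Term operations with arguments indexed by an arbitrary type *)

Definition term_op (A : clone) (X : Type) (F : (X -> A) -> A) : Prop :=
  exists n (f : operation A n) (e : 'I_n -> X),
    clone_op f /\ forall t, F t = f (t \o e).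

(** For the rotation of V_C this amounts to Σ_C. Allowing any self-map also covers the powers of a
    rotation, on which both separation and decomposition rest. *)
Definition has_invariant (A : clone) (X : Type) (s : X -> X) : Prop :=
  exists F : (X -> A) -> A, term_op F /\ forall t, F (t \o s) = F t.

Lemma clone_op_reindex (A : clone) n m (f : operation A n) (e : 'I_n -> 'I_m) :
  clone_op f -> clone_op (fun t : 'I_m -> A => f (t \o e)).
Proof.
by move=> Cf; apply: (clone_comp (g := fun i t => t (e i)) Cf) => i;
  apply: clone_proj.
Qed.

Lemma term_op_reindex (A : clone) (X Y : Type) (h : X -> Y)
    (F : (X -> A) -> A) :
  term_op F -> term_op (fun t : Y -> A => F (t \o h)).
Proof.
by move=> [n [f [e [Cf Ff]]]]; exists n, f, (h \o e); split=> // t; rewrite Ff.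
Qed.

Lemma term_op_proj (A : clone) (X : Type) (x : X) :
  term_op (fun t : X -> A => t x).
Proof.
by exists 1, (fun t => t ord0), (fun=> x); split=> //; apply: clone_proj.
Qed.

Lemma term_op_ord (A : clone) n (F : operation A n) :
  term_op F -> clone_op F.
Proof.
move=> [m [f [e [Cf Ff]]]].
rewrite (_ : F = fun t => f (t \o e)); first exact: clone_op_reindex.
by apply/funext => t; rewrite Ff.
Qed.

Lemma term_op_comp (A : clone) (X : Type) (Y : finType) (F : (X -> A) -> A)
    (G : X -> (Y -> A) -> A) :
  term_op F -> (forall x, term_op (G x)) ->
  term_op (fun t => F (fun x => G x t)).
Proof.
move=> [n [f [e [Cf Ff]]]] CG.
pose g i (t : 'I_#|Y| -> A) := G (e i) (t \o enum_rank).
exists #|Y|, (fun t => f (fun i => g i t)), enum_val; split=> [|t].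
  by apply: clone_comp => // i; apply/term_op_ord/term_op_reindex.
rewrite Ff; congr (f _); apply/funext => i /=; congr (G _ _).
by apply/funext => y /=; rewrite enum_rankK.
Qed.

(** Precomposing the arguments with [h] turns an [r]-invariant term into an [s]-invariant one. *)
Lemma has_invariant_hom (A : clone) (X Y : Type) (r : X -> X) (s : Y -> Y)
    (h : X -> Y) :
  (forall x, h (r x) = s (h x)) -> has_invariant A r -> has_invariant A s.
Proof.
move=> hrs [F [tF Fr]]; exists (fun t => F (t \o h)); split=> [|t].
  exact: term_op_reindex.
by rewrite -[RHS]Fr; congr (F _); apply/funext => x /=; rewrite hrs.
Qed.

Lemma has_invariant_iter (A : clone) (X : Type) (s : X -> X) n :
  has_invariant A s -> has_invariant A (iter n s).
Proof.
move=> [F [tF Fs]]; exists F; split=> //; elim: n => [//|n IHn] t.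
by rewrite -[RHS]Fs -[RHS]IHn; congr (F _); apply/funext => x.
Qed.

(** * Loop conditions as invariance of terms *)

Definition loop_holds (A : clone) (l : loop_condition) : Prop :=
  exists f : operation A (loop_arity l),
    clone_op f /\ forall x, f (x \o @loop_src l) = f (x \o @loop_tgt l).

Lemma satisfies_loop_set (A : clone) (L : set loop_condition) :
  satisfies A (loop_set L) <-> forall l, L l -> loop_holds A l.
Proof.
split=> [[I [CI HI]] l Ll|H].
  pose s : loop_signature L := exist _ l Ll.
  exists (I s); split; first exact: (CI s).
  by move=> x; apply: (HI (loop_identity s)); exists s.
exists (fun s : loop_signature L => sval (cid (H _ (svalP s)))).
by split=> [s|_ [s _ <-]]; case: (svalP (cid (H _ (svalP s)))).
Qed.

Lemma satisfies_loop (A : clone) (l : loop_condition) :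
  satisfies A (loop_set [set l]) <-> loop_holds A l.
Proof.
split=> [/satisfies_loop_set|Al]; first by apply.
by apply/satisfies_loop_set => _ ->.
Qed.

(** Every vertex has exactly one successor, so arguments indexed by edges can be re-indexed by their
    sources; conversely [e] picks an edge out of each vertex. *)
Lemma satisfies_has_invariant (A : clone) (l : loop_condition) (X : Type)
    (s : X -> X) (phi : X -> 'I_(loop_nvars l)) :
  bijective phi ->
  (forall u v, loop_edge (phi u) (phi v) <-> v = s u) ->
  satisfies A (loop_set [set l]) <-> has_invariant A s.
Proof.
move=> [psi phiK psiK] Es; split=> [/satisfies_loop[f [Cf Hf]]|].
  exists (fun t => f (t \o (psi \o @loop_src l))); split=> [|t].
    by exists (loop_arity l), f, (psi \o @loop_src l).
  have E i : s (psi (loop_src i)) = psi (loop_tgt i).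
    by apply/esym/Es; rewrite !psiK; exists i.
  rewrite -[RHS]/(f ((t \o psi) \o @loop_src l)) Hf; congr (f _).
  by apply/funext => i /=; rewrite E.
move=> [F [tF Fs]]; apply/satisfies_loop.
have /choice[e eP] x : exists i, loop_src i = phi x /\ loop_tgt i = phi (s x).
  by apply/Es.
exists (fun t => F (t \o e)); split=> [|t].
  exact/term_op_ord/term_op_reindex.
transitivity (F (t \o phi)); last rewrite -[LHS]Fs;
  by congr (F _); apply/funext => x /=; have [E1 E2] := eP x; rewrite ?E1 ?E2.
Qed.

(** * Maps equivariant under two periodic self-maps *)

Lemma iterM_id (T : Type) (f : T -> T) n k x :
  iter n f x = x -> iter (n * k) f x = x.
Proof.
by move=> fx; rewrite mulnC; elim: k => //= k IHk; rewrite mulSn iterD IHk.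
Qed.

Section Equivariant.

Variables (X V : Type) (r : X -> X) (s : V -> V) (K N : nat).
Hypotheses (K_gt0 : 0 < K) (N_gt0 : 0 < N).
Hypotheses (rK : forall x, iter K r x = x) (sN : forall v, iter N s v = v).
Implicit Types t : X -> V.

(** The joint action of the powers of [s] and [r]. Exponents stay natural numbers: multiplying by
    [N.-1], respectively [K.-1], serves as negation, because [N] and [K] are periods. *)
Let twist m j t : X -> V := fun x => iter m s (t (iter j r x)).

Let twistD m j m' j' t : twist m j (twist m' j' t) = twist (m + m') (j' + j) t.
Proof. by apply/funext => x; rewrite /twist !iterD. Qed.

Let twistNM m k t j : twist (m + N * k) j t = twist m j t.
Proof. by apply/funext => x; rewrite /twist iterD iterM_id. Qed.

Let twistKM m k t : twist m (K * k) t = twist m 0 t.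
Proof. by apply/funext => x; rewrite /twist iterM_id. Qed.

Let twist_sym m j t t' :
  t' = twist m j t -> exists m' j', t = twist m' j' t'.
Proof.
move=> ->; exists (m * N.-1), (j * K.-1); rewrite twistD.
rewrite -mulnSr -mulnS !prednK // -[m * N]add0n [m * N]mulnC [j * K]mulnC.
by rewrite twistNM twistKM.
Qed.

Let twist_rel t t' := exists m j, t' = twist m j t.

Let twist_rel_sym t t' : twist_rel t t' -> twist_rel t' t.
Proof. by move=> [m [j /twist_sym]]. Qed.

Let twist_rel_trans t1 t2 t3 :
  twist_rel t1 t2 -> twist_rel t2 t3 -> twist_rel t1 t3.
Proof.
move=> [m [j ->]] [m' [j' ->]]; rewrite twistD.
by exists (m' + m), (j + j').
Qed.

(** This makes the assignment of [iter m s v] to [twist m j t] well defined on the orbit of [t]: two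
    presentations of one map differ by a stabilizing pair. *)
Let twist_stab t v m j m' j' :
  (forall i k, twist i k t = t -> iter i s v = v) ->
  twist m j t = twist m' j' t -> iter m s v = iter m' s v.
Proof.
move=> vP E.
(* Acting with the inverses of [m'] and [j] leaves only an [s]-exponent on the left and only an
   [r]-exponent on the right. *)
have {E} : twist (m' * N.-1 + m) (j + j * K.-1) t =
    twist (m' * N.-1 + m') (j' + j * K.-1) t by rewrite -!twistD E.
rewrite -mulnSr -mulnS !prednK // -[m' * N]add0n [m' * N]mulnC [j * K]mulnC.
rewrite twistNM twistKM; set J := j' + _ => E.
have /vP Ev : twist (m' * N.-1 + m) (J * K.-1) t = t.
  have -> : twist (m' * N.-1 + m) (J * K.-1) t =
      twist 0 (J * K.-1) (twist (m' * N.-1 + m) 0 t) by rewrite twistD !add0n.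
  rewrite E twistD addn0 -mulnS prednK //.
  by rewrite mulnC twistKM.
by rewrite -[in RHS]Ev -iterD addnA -mulnS prednK // addnC iterD mulnC iterM_id.
Qed.

Hypothesis no_hom : forall t j, ~ (forall x, t (iter j r x) = s (t x)).
Hypothesis prime_cycles :
  forall p, prime p -> p %| N -> exists v, iter p s v = v.

(** The [s]-exponents in the stabilizer of [t] are multiples of the least positive one, [d], which
    divides [N]. If [d] were 1, [t] would be a homomorphism from a power of [r] to [s]; otherwise a
    prime [p] divides [d], and a point fixed by the [p]-th power of [s] works. *)
Let stab_fixes t :
  exists v, forall m j, twist m j t = t -> iter m s v = v.
Proof.
pose per m := `[< exists j, twist m j t = t >].
have perP m : reflect (exists j, twist m j t = t) (per m) by apply: asboolP.
have perD m m' : per m -> per m' -> per (m + m').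
  move=> /perP[j Ej] /perP[j' Ej']; apply/perP; exists (j' + j).
  by rewrite -twistD Ej'.
have perM m k : per m -> per (m * k).
  move=> Pm; elim: k => [|k IHk]; first by rewrite muln0; apply/perP; exists 0.
  by rewrite mulnS perD.
have perNM m k : per (m + N * k) -> per m.
  by move=> /perP[j Ej]; apply/perP; exists j; rewrite twistNM in Ej.
have PN : per N by apply/perP; exists 0; apply/funext => x; apply: sN.
have [|d /andP[d_gt0 Pd] dmin] := @ex_minnP (fun m => (0 < m) && per m).
  by exists N; rewrite N_gt0.
have dvd m : per m -> d %| m.
  move=> Pm; rewrite /dvdn; case: posnP => // r_gt0.
  have: d <= m %% d.
    (* Instead of subtracting [m %/ d * d], its multiple by [N.-1] is added. *)
    apply: dmin; rewrite r_gt0 /=; apply: (perNM _ (m %/ d * d)).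
    rewrite -{1}[N]prednK // mulSn addnA [_ + _ * d]addnC -divn_eq.
    by rewrite perD // mulnC -mulnA mulnC -mulnA perM.
  by rewrite leqNgt ltn_pmod.
have d_neq1 : d != 1.
  apply/eqP => d1; move: Pd; rewrite d1 => /perP[j Ej].
  (* This exponent inverts [iter j r], turning s (t (r^j x)) = t x into the homomorphism
     equation. *)
  apply: (@no_hom t (j * K.-1)) => x.
  rewrite -{1}Ej /twist /= -iterD -mulnS prednK // mulnC.
  by rewrite iterM_id.
have [||v vP] := @prime_cycles (pdiv d).
- by rewrite pdiv_prime // ltn_neqAle eq_sym d_neq1.
- exact: dvdn_trans (pdiv_dvd _) (dvd _ PN).
exists v => m j Em.
have /(dvdn_trans (pdiv_dvd d))/dvdnP[k ->] : d %| m.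
  by apply: dvd; apply/perP; exists j.
by rewrite mulnC iterM_id.
Qed.

(** On each orbit, a representative goes to a point fixed by its stabilizer, and the rest of the
    orbit follows by equivariance. *)
Lemma equivariant_exists (v0 : V) :
  exists F : (X -> V) -> V,
    (forall t, F (t \o r) = F t) /\ (forall t, F (s \o t) = s (F t)).
Proof.
have /choice[v vP] := stab_fixes.
(* The representative depends on the class as a set only, so equivalent maps share it; the constant
   [v0] is the default for the empty set. *)
have /choice[rep repP] (c : set (X -> V)) : exists t, forall t', c t' -> c t.
  have [[t ct]|nc] := pselect (exists t, c t); first by exists t.
  by exists (fun=> v0) => t ct; case: nc; exists t.
pose class t : set (X -> V) := twist_rel t.
have class_eq t t' : twist_rel t t' -> class t = class t'.
  move=> tt'; apply/seteqP; split=> t'' /=; apply: twist_rel_trans => //.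
  exact: twist_rel_sym.
have /choice[m mP] t : exists m, exists j, t = twist m j (rep (class t)).
  apply/twist_rel_sym/(repP (class t) t).
  by exists 0, 0.
(* The chosen exponent [m] need not be additive, but its effect on the fixed point is. *)
have mE t i k : twist_rel t (twist i k t) ->
    iter (m (twist i k t)) s (v (rep (class t))) =
    iter (i + m t) s (v (rep (class t))).
  move=> E; have [j] := mP (twist i k t); have [j' {1}->] := mP t.
  rewrite -(class_eq _ _ E) twistD => E'.
  by apply/esym/(twist_stab (vP _) E').
exists (fun t => iter (m t) s (v (rep (class t)))); split=> t.
  have E : twist_rel t (twist 0 1 t) by exists 0, 1.
  by rewrite -[t \o r]/(twist 0 1 t) -(class_eq _ _ E) mE.
have E : twist_rel t (twist 1 0 t) by exists 1, 0.
by rewrite -[s \o t]/(twist 1 0 t) -(class_eq _ _ E) mE.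
Qed.

End Equivariant.

(** * Powers of rotations and homomorphisms between unions of cycles *)

Lemma val_iter_ordS n u (k : 'I_n) : iter u (@ordS n) k = (k + u) %% n :> nat.
Proof.
elim: u => [|u IHu] /=; first by rewrite addn0 modn_small.
by rewrite IHu -addn1 modnDml addn1 addnS.
Qed.

Lemma iter_cycles_succ (I : Type) (c : I -> nat) n (u : {i : I & 'I_(c i)}) :
  iter n (@cycles_succ I c) u =
  existT _ (tag u) (iter n (@ordS (c (tag u))) (tagged u)).
Proof. by elim: n => [|n IHn] /=; [case: u | rewrite IHn]. Qed.

Lemma iter_cycles_id (I : Type) (c : I -> nat) n (u : {i : I & 'I_(c i)}) :
  c (tag u) %| n -> iter n (@cycles_succ I c) u = u.
Proof.
case: u => i k /= cn; rewrite iter_cycles_succ /=; congr existT.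
apply: val_inj; rewrite /= val_iter_ordS -modnDmr (eqP cn) addn0.
by rewrite modn_small.
Qed.

(* On a cycle of length a, k |-> k %/ gcd a u turns the shift by u into the
   shift by u / gcd a u on a cycle of length a / gcd a u; multiplying by an
   inverse w of u / gcd a u then gives the shift by 1. *)
Lemma cycles_hom (I J : Type) (c : I -> nat) (d : J -> nat) (u : nat) :
  (forall i, 0 < c i) -> (forall j, 0 < d j) ->
  (forall i, exists j, d j %| c i %/ gcdn (c i) u) ->
  exists h : {i : I & 'I_(c i)} -> {j : J & 'I_(d j)},
    forall x, h (iter u (@cycles_succ I c) x) = cycles_succ (h x).
Proof.
move=> c_gt0 d_gt0 /choice[j jP].
have /choice[w wP] i : exists w, w * (u %/ gcdn (c i) u) = 1 %[mod d (j i)].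
  have g_gt0 : 0 < gcdn (c i) u by rewrite gcdn_gt0 c_gt0.
  have co : coprime (d (j i)) (u %/ gcdn (c i) u).
    apply: coprime_dvdl (jP i) _.
    by rewrite /coprime -(eqn_pmul2r g_gt0) muln_gcdl mul1n !divnK
      ?dvdn_gcdl ?dvdn_gcdr.
  (* A number congruent to 1 modulo [d (j i)] and divisible by u / gcd; the cofactor is the
     inverse. *)
  have /dvdnP[w Ew] :
      u %/ gcdn (c i) u %| chinese (d (j i)) (u %/ gcdn (c i) u) 1 0.
    by rewrite /dvdn (chinese_modr co) mod0n.
  by exists w; rewrite -Ew (chinese_modl co).
pose h i (k : 'I_(c i)) := k %/ gcdn (c i) u * w i.
exists (fun x => existT (fun j' => 'I_(d j')) (j (tag x))
  (Ordinal (ltn_pmod (h _ (tagged x)) (d_gt0 (j (tag x)))))).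
move=> [i k]; rewrite iter_cycles_succ /cycles_succ /=; congr existT.
apply: val_inj; rewrite /= /h val_iter_ordS.
have g_gt0 : 0 < gcdn (c i) u by rewrite gcdn_gt0 c_gt0.
set g := gcdn _ _ in g_gt0 *.
have -> : (k + u) %% c i %/ g = (k %/ g + u %/ g) %% (c i %/ g).
  by rewrite -divnDr ?dvdn_gcdr // modn_divl divnK ?dvdn_gcdl.
rewrite -modnMml (modn_dvdm _ (jP i)) modnMml mulnDl -[in RHS]addn1 modnDml.
by rewrite -modnDmr [u %/ g * _]mulnC wP modnDmr.
Qed.

(** Feed [G] at vertex (j, k) with [F j] evaluated on [t] shifted by u k. A further shift by u moves
    k to k + 1, and the wrap-around u c_j is absorbed by [F j]. *)
Lemma has_invariant_step (A : clone) (X J : finType) (s : X -> X)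
    (c : J -> nat) u :
  has_invariant A (@cycles_succ J c) ->
  (forall j, has_invariant A (iter (u * c j) s)) ->
  has_invariant A (iter u s).
Proof.
move=> [G [tG Gs]] /choice[F FP].
pose H (x : {j : J & 'I_(c j)}) (t : X -> A) :=
  F (tag x) (t \o iter (u * (tagged x : 'I_(c (tag x)))) s).
exists (fun t => G (fun x => H x t)); split=> [|t].
  apply: term_op_comp => // -[j k].
  by apply: term_op_reindex; case: (FP j).
rewrite -[RHS]Gs; congr (G _); apply/funext => -[j k]; rewrite /H /=.
have [_ Fj] := FP j.
have Fjn n t' : F j (t' \o iter (u * c j * n) s) = F j t'.
  elim: n => [|n IHn]; first by rewrite muln0; congr (F j _).
  rewrite -[RHS]IHn -[RHS]Fj; congr (F j _); apply/funext => x /=.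
  by rewrite -iterD mulnSr.
(* [k.+1 %/ c j] counts the completed turns, so that the reduced index can be replaced by k + 1. *)
rewrite -[RHS](Fjn (k.+1 %/ c j)); congr (F j _); apply/funext => x /=.
rewrite -!iterD -mulnA -mulnDr [c j * _]mulnC [_ %% _ + _]addnC -divn_eq.
by rewrite mulnS.
Qed.

Lemma has_invariant_proj (A : clone) (X : Type) (s : X -> X) x :
  s x = x -> has_invariant A s.
Proof.
move=> sx; exists (fun t => t x); split=> [|t]; first exact: term_op_proj.
by rewrite /= sx.
Qed.

Lemma has_invariant_dvd (A : clone) (I J : Type) (c : I -> nat) (d : J -> nat) :
  (forall i, 0 < c i) -> (forall j, 0 < d j) ->
  (forall i, exists j, d j %| c i) ->
  has_invariant A (@cycles_succ I c) -> has_invariant A (@cycles_succ J d).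
Proof.
move=> c_gt0 d_gt0 dc.
have [|h hP] := @cycles_hom I J c d 1 c_gt0 d_gt0.
  by move=> i; have [j] := dc i; exists j; rewrite gcdn1 divn1.
exact: has_invariant_hom hP.
Qed.

(** * The conditions Σ_C up to equivalence *)

Definition length_succ (C : length_set) : cycle_vertex C -> cycle_vertex C :=
  @cycles_succ (lengths C) val.

Lemma length_gt0 (C : length_set) (a : lengths C) : 0 < val a.
Proof.
by rewrite lt0n; apply: contraNneq (lengths_pos C) => <-; apply: valP.
Qed.

Lemma satisfies_Sigma (A : clone) (C : length_set) :
  satisfies A (loop_set [set Sigma_ C]) <-> has_invariant A (@length_succ C).
Proof.
apply: (@satisfies_has_invariant _ (Sigma_ C) _ _
  (enum_rank : cycle_vertex C -> _)).
  exact: enum_rank_bij.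
move=> u v; split=> [[i /= [-> /enum_rank_inj<-]]|->].
  by rewrite enum_rankK.
by exists (enum_rank u); rewrite /= enum_rankK.
Qed.

Lemma is_cyclic_Sigma (C : length_set) : is_cyclic (Sigma_ C).
Proof.
pose c (j : 'I_#|{: lengths C}|) : nat := val (enum_val j).
pose h (u : {j & 'I_(c j)}) : cycle_vertex C :=
  existT (fun a : lengths C => 'I_(val a)) (enum_val (tag u)) (tagged u).
have h_inj : injective h.
  move=> [i k] [j l] E.
  have ij : i = j by apply: enum_val_inj; apply: (congr1 tag E).
  subst j; congr existT; apply/eqP.
  rewrite -(@eq_Tagged _ (fun a : lengths C => 'I_(val a)) (h (existT _ i k))).
  exact/eqP.
have h_surj x : exists u, h u = x.
  case: x => a; rewrite -(enum_rankK a) => k.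
  by exists (existT _ (enum_rank a) k).
have [g gP] := choice h_surj.
exists #|{: lengths C}|, c, (fun u => enum_rank (h u)); split.
- by have /fset0Pn[a aC] := lengths_neq0 C; apply/card_gt0P; exists [` aC]%fset.
- by move=> j; apply: length_gt0.
- exists (fun i => g (enum_val i)) => [u|i]; last by rewrite gP enum_valK.
  by apply: h_inj; rewrite gP enum_rankK.
move=> u v; split=> [[i /= [-> /enum_rank_inj]]|->].
  by rewrite enum_rankK => E; apply/h_inj; rewrite -E.
by exists (enum_rank (h u)); rewrite /= enum_rankK.
Qed.

(** Repeated cycles do not matter: unions of cycles with the same set of lengths map homomorphically
    to each other. *)
Lemma is_cyclic_equiv_Sigma (l : loop_condition) :
  is_cyclic l ->
  exists C : length_set, h1_equiv (loop_set [set l]) (loop_set [set Sigma_ C]).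
Proof.
move=> [k [c [phi [k_gt0 c_gt0 phi_bij phiE]]]].
pose S : {fset nat} := [fset c j | j in 'I_k]%fset.
have S_neq0 : S != fset0.
  by apply/fset0Pn; exists (c (Ordinal k_gt0)); apply: in_imfset.
have S_pos : 0 \notin S.
  by apply/imfsetP => -[j _ c0]; have := c_gt0 j; rewrite -c0.
pose C := LengthSet S_neq0 S_pos.
have AE A := @satisfies_has_invariant A l _ _ phi phi_bij phiE.
exists C; split=> A.
  move=> /AE Ac; apply/satisfies_Sigma; apply: has_invariant_dvd Ac => //.
    exact: length_gt0.
  have cS j : c j \in S by apply: in_imfset.
  by move=> j; exists [` cS j]%fset.
move=> /satisfies_Sigma invC; apply/AE; apply: has_invariant_dvd invC => //.
  exact: length_gt0.
by move=> a; have /imfsetP[j _ ->] := valP a; exists j.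
Qed.

(** * Separation by polymorphism clones of unions of prime cycles *)

Definition centralizer_clone (V : Type) (v0 : inhabited V) (s : V -> V) : clone.
Proof.
refine (@Clone V v0
  (fun n f => 0 < n /\ forall t, f (s \o t) = s (f t)) _ _ _).
- by move=> n f [].
- by move=> n i; split=> //; apply: leq_trans (ltn_ord i).
- move=> n m f g [n_gt0 fs] gs; split=> [|t].
    by case: (gs (Ordinal n_gt0)).
  rewrite -fs; congr (f _); apply/funext => i /=.
  by case: (gs i).
Defined.

Lemma cycle_vertex_inhabited (C : length_set) : inhabited (cycle_vertex C).
Proof. by have /card_gt0P[v _] := cycle_vertex_gt0 C; exists. Qed.

Definition cycle_clone (C : length_set) : clone :=
  centralizer_clone (cycle_vertex_inhabited C) (@length_succ C).

Definition prime_lengths (P : length_set) : Prop :=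
  forall p, p \in lengths P -> prime p.

(** Evaluated at the identity tuple, an invariant term commuting with σ_P yields a fixed point of
    σ_P, whereas all cycles are longer than 1. *)
Lemma cycle_cloneN (P : length_set) :
  prime_lengths P -> ~ satisfies (cycle_clone P) (loop_set [set Sigma_ P]).
Proof.
move=> Pp /satisfies_Sigma[F [[n [f [e [[n_gt0 fs] Ff]]]] Fs]].
have := Fs id; rewrite !Ff -[in LHS]/(f (@length_succ P \o (id \o e))) fs.
case: (f _) => p k; rewrite /length_succ /cycles_succ /= => /eqP.
rewrite eq_Tagged /= -val_eqE /= => /eqP E.
have p_gt1 : 1 < val p by apply/prime_gt1/Pp/valP.
have : k + 1 == k + 0 %[mod val p] by rewrite addn0 addn1 E modn_small.
by rewrite eqn_modDl !modn_small // ltnW.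
Qed.

Lemma Sigma_implies_or_cycle_clone (l : loop_condition) (P : length_set) :
  is_cyclic l -> prime_lengths P ->
  h1_implies (loop_set [set l]) (loop_set [set Sigma_ P]) \/
  satisfies (cycle_clone P) (loop_set [set l]).
Proof.
move=> [k [c [phi [k_gt0 c_gt0 phi_bij phiE]]]] Pp.
have AE A := @satisfies_has_invariant A l _ _ phi phi_bij phiE.
have [[t [j hom]]|nohom] := pselect (exists
    (t : {i & 'I_(c i)} -> cycle_vertex P) j, forall x,
      t (iter j (@cycles_succ _ c) x) = length_succ (t x)).
  left=> A /AE Al; apply/satisfies_Sigma.
  exact/(has_invariant_hom hom)/has_invariant_iter.
right; apply/AE.
have [v0] := cycle_vertex_inhabited P.
(* The products of the cycle lengths are common periods. A prime dividing the product of [P] belongs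
   to [P], so any vertex of that cycle has the required period. *)
have [||||||F [Fr Fs]] := @equivariant_exists {i & 'I_(c i)} (cycle_vertex P)
  (@cycles_succ _ c) (@length_succ P) (\prod_i c i)
  (\prod_(p : lengths P) val p) _ _ _ _ _ _ v0.
- by apply/prodn_gt0.
- by apply/prodn_gt0/length_gt0.
- by move=> x; apply: iter_cycles_id; rewrite (bigD1 (tag x)) //= dvdn_mulr.
- by move=> x; apply: iter_cycles_id; rewrite (bigD1 (tag x)) //= dvdn_mulr.
- by move=> t j hom; apply: nohom; exists t, j.
- move=> p p_pr.
  rewrite (big_morph _ (fun m n => Euclid_dvdM m n p_pr) (Euclid_dvd1 p_pr)).
  rewrite big_has => /hasP[/= q _ pq].
  have k0 : 'I_(val q) := Ordinal (length_gt0 q).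
  exists (existT (fun a : lengths P => 'I_(val a)) q k0).
  apply: iter_cycles_id => /=.
  by move: pq; rewrite dvdn_prime2 // ?Pp ?valP // => /eqP->.
exists F; split=> //.
exists _, (fun t => F (t \o enum_rank)), enum_val; split=> [|t].
  split=> [|t]; last by rewrite -Fs.
  apply/card_gt0P; exists (existT (fun i => 'I_(c i)) (Ordinal k_gt0) (Ordinal (c_gt0 _))).
  by [].
by congr (F _); apply/funext => x /=; rewrite enum_rankK.
Qed.

(** If no member implied Σ_P, the single clone [cycle_clone P] would satisfy all members at once. *)
Lemma loop_set_implies_Sigma (L : set loop_condition) (P : length_set) :
  (forall l, L l -> is_cyclic l) -> prime_lengths P ->
  h1_implies (loop_set L) (loop_set [set Sigma_ P]) ->
  exists2 l, L l & h1_implies (loop_set [set l]) (loop_set [set Sigma_ P]).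
Proof.
move=> Lc Pp LP; apply: contrapT => nL; apply: (cycle_cloneN Pp); apply: LP.
apply/satisfies_loop_set => l Ll; apply/satisfies_loop.
have [lP|//] := Sigma_implies_or_cycle_clone (Lc l Ll) Pp.
by case: nL; exists l.
Qed.

(** * Decomposition into sets of primes, and finite conjunctions *)

Definition length_prod (C : length_set) : nat := \prod_(a : lengths C) val a.

Lemma length_prod_gt0 C : 0 < length_prod C.
Proof. exact/prodn_gt0/length_gt0. Qed.

Lemma dvdn_length_prod (C : length_set) (a : lengths C) :
  val a %| length_prod C.
Proof. by rewrite /length_prod (bigD1 a) //= dvdn_mulr. Qed.

Lemma iter_length_succ (C : length_set) (x : cycle_vertex C) n :
  val (tag x) %| n -> iter n (@length_succ C) x = x.
Proof. exact: iter_cycles_id. Qed.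

(* If all multiples u p by primes p dividing m = N / u are periods of invariant
   terms, then so is u, by the condition for the set of primes dividing m. *)
Lemma satisfies_Sigma_primes (A : clone) (C : length_set) :
  (forall Q : length_set, prime_lengths Q ->
    (forall q, q \in lengths Q -> q \in primes (length_prod C)) ->
    h1_implies (loop_set [set Sigma_ C]) (loop_set [set Sigma_ Q]) ->
    satisfies A (loop_set [set Sigma_ Q])) ->
  satisfies A (loop_set [set Sigma_ C]).
Proof.
move=> AQ; apply/satisfies_Sigma.
suff H m u : u * m = length_prod C -> has_invariant A (iter u (@length_succ C)).
  by apply: (H (length_prod C) 1); rewrite mul1n.
have [n] := ubnP m; elim: n m u => // n IHn m u /ltnSE le_mn um.
have N_gt0 := length_prod_gt0 C.
have [u_gt0 m_gt0] : 0 < u /\ 0 < m by apply/andP; rewrite -muln_gt0 um.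
(* If a length divides [u], the [u]-th power of the rotation fixes a vertex and a projection is
   invariant. This covers [m = 1]. *)
have [[a au]|nau] := pselect (exists a : lengths C, val a %| u).
  pose x : cycle_vertex C :=
    existT (fun b : lengths C => 'I_(val b)) a (Ordinal (length_gt0 a)).
  exact: (@has_invariant_proj _ _ _ x (iter_length_succ _)).
(* Now a / gcd(a, u) exceeds 1, and it divides [m]: a divides u m, and the quotient is coprime to u
   / gcd(a, u). *)
have quot (a : lengths C) :
    exists2 q, q \in primes m & q %| val a %/ gcdn (val a) u.
  have g_gt0 : 0 < gcdn (val a) u by rewrite gcdn_gt0 length_gt0.
  have q_pr : prime (pdiv (val a %/ gcdn (val a) u)).
    apply: pdiv_prime; rewrite ltn_divRL ?dvdn_gcdl // mul1n.
    rewrite ltn_neqAle dvdn_leq ?dvdn_gcdl ?length_gt0 // andbT.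
    by apply/negP => /eqP E; apply: nau; exists a; rewrite -E dvdn_gcdr.
  exists (pdiv (val a %/ gcdn (val a) u)); last exact: pdiv_dvd.
  rewrite mem_primes q_pr m_gt0 /=; apply: dvdn_trans (pdiv_dvd _) _.
  have co : coprime (val a %/ gcdn (val a) u) (u %/ gcdn (val a) u).
    by rewrite /coprime -(eqn_pmul2r g_gt0) muln_gcdl mul1n !divnK
      ?dvdn_gcdl ?dvdn_gcdr.
  rewrite -(Gauss_dvdr _ co) -(dvdn_pmul2r g_gt0) divnK ?dvdn_gcdl //.
  by rewrite mulnAC divnK ?dvdn_gcdr // um dvdn_length_prod.
pose S : {fset nat} := [fset q | q in primes m]%fset.
have SE q : (q \in S) = (q \in primes m) by rewrite !inE.
have S_neq0 : S != fset0.
  have /fset0Pn[a aC] := lengths_neq0 C; apply/fset0Pn.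
  by have [q qm _] := quot [` aC]%fset; exists q; rewrite SE.
have S_pos : 0 \notin S by rewrite SE mem_primes.
pose Q := LengthSet S_neq0 S_pos.
have QE q : (q \in lengths Q) = (q \in primes m) := SE q.
have Q_pr : prime_lengths Q by move=> q; rewrite QE mem_primes => /andP[].
(* The prime divisors just found map the [u]-th power of the rotation of [C] to that of [Q], so Σ_C
   implies Σ_Q. *)
have [|h hP] := @cycles_hom (lengths C) (lengths Q) val val u (@length_gt0 C)
    (@length_gt0 Q).
  move=> a; have [q qm qa] := quot a.
  by rewrite -QE in qm; exists [` qm]%fset.
have /satisfies_Sigma invQ : satisfies A (loop_set [set Sigma_ Q]).
  apply: AQ => // [q|B /satisfies_Sigma invC].
    rewrite QE !mem_primes N_gt0 m_gt0 => /and3P[-> _ qm] /=.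
    by rewrite -um dvdn_mull.
  apply/satisfies_Sigma; apply: has_invariant_hom hP _.
  exact: has_invariant_iter.
apply: has_invariant_step invQ _ => q.
have : val q \in primes m by rewrite -QE; apply: valP.
rewrite mem_primes => /and3P[q_pr _ /dvdnP[m' Em]].
apply: (IHn m'); last by rewrite -um Em -mulnA [m' * _]mulnC.
apply: leq_trans le_mn; rewrite Em ltn_Pmulr ?prime_gt1 //.
by move: m_gt0; rewrite Em muln_gt0 => /andP[].
Qed.

(** The lengths of E are the products ab. Σ_C reduces the period 1 to the periods a, and Σ_D reduces
    a to ab, where a projection to the cycle of length ab is invariant. *)
Lemma Sigma_and (C D : length_set) :
  exists E : length_set, forall A,
    satisfies A (loop_set [set Sigma_ E]) <->
    satisfies A (loop_set [set Sigma_ C]) /\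
    satisfies A (loop_set [set Sigma_ D]).
Proof.
pose S : {fset nat} := [fset a * b | a in lengths C, b in lengths D]%fset.
have SM a b : a \in lengths C -> b \in lengths D -> a * b \in S.
  by move=> aC bD; apply: in_imfset2.
have SE e : e \in S ->
    exists (a : lengths C) (b : lengths D), e = val a * val b.
  by case/imfset2P => a aC [b bD ->]; exists [` aC]%fset, [` bD]%fset.
have S_neq0 : S != fset0.
  have /fset0Pn[a aC] := lengths_neq0 C; have /fset0Pn[b bD] := lengths_neq0 D.
  by apply/fset0Pn; exists (a * b); apply: SM.
have S_pos : 0 \notin S.
  apply/negP => /SE[a [b E]]; have := length_gt0 a; have := length_gt0 b.
  by case: (val a) (val b) E => [|?] [|?].
pose E := LengthSet S_neq0 S_pos.
have EE (e : lengths E) :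
    exists (a : lengths C) (b : lengths D), val e = val a * val b.
  exact/SE/valP.
exists E => A; split=> [/satisfies_Sigma invE|[]].
  split; apply/satisfies_Sigma;
    apply: has_invariant_dvd invE; try exact: length_gt0;
    move=> e; have [a [b ->]] := EE e.
    by exists a; rewrite dvdn_mulr.
  by exists b; rewrite dvdn_mull.
move=> /satisfies_Sigma invC /satisfies_Sigma invD; apply/satisfies_Sigma.
apply: (@has_invariant_step _ _ _ (@length_succ E) _ 1 invC) => a.
apply: has_invariant_step invD _ => b.
have abE : val a * val b \in lengths E by apply: SM; apply: valP.
pose x : cycle_vertex E :=
  existT (fun e : lengths E => 'I_(val e)) [` abE]%fset (Ordinal (length_gt0 _)).
apply: (@has_invariant_proj _ _ _ x); apply: iter_length_succ.
by rewrite mul1n /=.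
Qed.

Lemma Sigma_and_finite k (P : 'I_k -> length_set) :
  exists C : length_set, forall A,
    satisfies A (loop_set [set Sigma_ C]) <->
    forall i, satisfies A (loop_set [set Sigma_ (P i)]).
Proof.
suff H (s : seq 'I_k) : exists C : length_set, forall A,
    satisfies A (loop_set [set Sigma_ C]) <->
    forall i, i \in s -> satisfies A (loop_set [set Sigma_ (P i)]).
  have [C CP] := H (enum 'I_k); exists C => A; rewrite CP.
  by split=> AP i => [|_]; apply: AP; rewrite mem_enum.
elim: s => [|i s [C CP]].
  (* The empty conjunction is the condition for the set {1}, satisfied by a projection. *)
  have one_neq0 : [fset 1]%fset != fset0 :> {fset nat}.
    by apply/fset0Pn; exists 1; rewrite inE.
  have one_pos : 0 \notin [fset 1]%fset by rewrite inE.
  pose C := LengthSet one_neq0 one_pos.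
  exists C => A; split=> // _; apply/satisfies_Sigma.
  have aC : 1 \in lengths C by rewrite inE.
  pose x : cycle_vertex C :=
    existT (fun b : lengths C => 'I_(val b)) [` aC]%fset (Ordinal (length_gt0 _)).
  exact: (@has_invariant_proj _ _ (iter 1 (@length_succ C)) x
    (iter_length_succ _)).
have [D DP] := Sigma_and (P i) C; exists D => A; rewrite DP CP.
split=> [[Ai As] j|AP]; first by rewrite inE => /orP[/eqP->|/As].
by split=> [|j js]; apply: AP; rewrite inE ?eqxx ?js ?orbT.
Qed.

(** * The posets of classes and their isomorphisms *)

Lemma loop_set_implies_mem (L : set loop_condition) l :
  L l -> h1_implies (loop_set L) (loop_set [set l]).
Proof. by move=> Ll A /satisfies_loop_set AL; apply/satisfies_loop/AL. Qed.

Lemma implies_loop_set (Gamma : h1_set) (L : set loop_condition) :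
  (forall l, L l -> h1_implies Gamma (loop_set [set l])) ->
  h1_implies Gamma (loop_set L).
Proof.
move=> GL A AG; apply/satisfies_loop_set => l Ll.
exact/satisfies_loop/(GL l Ll).
Qed.

Lemma is_prime_cyclic_cyclic l : is_prime_cyclic l -> is_cyclic l.
Proof. by move=> [P [_ ->]]; apply: is_cyclic_Sigma. Qed.

(** Each member of [L] follows from the prime conditions it implies, and these are among the
    consequences of [L]. *)
Lemma implies_of_primes (Gamma : h1_set) (L : set loop_condition) :
  (forall l, L l -> is_cyclic l) ->
  (forall P, prime_lengths P ->
    h1_implies (loop_set L) (loop_set [set Sigma_ P]) ->
    h1_implies Gamma (loop_set [set Sigma_ P])) ->
  h1_implies Gamma (loop_set L).
Proof.
move=> Lc GP; apply: implies_loop_set => l Ll.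
have [C [lC Cl]] := is_cyclic_equiv_Sigma (Lc l Ll).
move=> A AG; apply: Cl; apply: satisfies_Sigma_primes => Q Q_pr _ CQ.
apply: GP AG => // B BL.
exact/CQ/lC/(loop_set_implies_mem Ll).
Qed.

Definition primes_below (X : h1_set -> Prop) : (h1_set -> Prop) -> Prop :=
  fun Y => M_PCL Y /\ class_le Y X.

Lemma primes_belowE (Gamma : h1_set) (Y : h1_set -> Prop) :
  primes_below (h1_class Gamma) Y <->
  exists P, [/\ prime_lengths P, Y = h1_class (loop_set [set Sigma_ P]) &
    h1_implies Gamma (loop_set [set Sigma_ P])].
Proof.
split=> [[[_ [P [P_pr ->]] ->] /class_leE GP]|[P [P_pr -> GP]]].
  by exists P.
by split; [exists (Sigma_ P) => //; exists P | apply/class_leE].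
Qed.

Lemma M_PCL_Sigma P :
  prime_lengths P -> M_PCL (h1_class (loop_set [set Sigma_ P])).
Proof. by move=> P_pr; exists (Sigma_ P) => //; exists P. Qed.

Lemma class_le_trans (X Y Z : h1_set -> Prop) :
  class_le X Y -> class_le Y Z -> class_le X Z.
Proof.
move=> [S [G [-> -> GS]]] [G' [D [/h1_class_eq[GG' G'G] -> DG']]].
by exists S, D; split=> // A /DG'/G'G/GS.
Qed.

Lemma class_le_primes_below (X X' : h1_set -> Prop) :
  frakM_CL X -> frakM_CL X' ->
  class_le X X' <-> included (primes_below X) (primes_below X').
Proof.
move=> [L Lc ->] [L' _ ->]; split=> [XX' Y [MY YX]|sub].
  by split=> //; apply: class_le_trans XX'.
apply/class_leE; apply: implies_of_primes => // P P_pr LP.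
apply/class_leE; apply: (proj2 (sub _ _)); apply/primes_belowE.
by exists P.
Qed.

Lemma primes_below_inj (X X' : h1_set -> Prop) :
  frakM_CL X -> frakM_CL X' -> primes_below X = primes_below X' -> X = X'.
Proof.
move=> MX MX' E.
have : class_le X X' by apply/(class_le_primes_below MX MX'); rewrite E => ?.
have : class_le X' X by apply/(class_le_primes_below MX' MX); rewrite E => ?.
case: MX MX' => [L _ ->] [L' _ ->] /class_leE ? /class_leE ?.
exact/h1_class_eq.
Qed.

Lemma is_downset_primes_below (X : h1_set -> Prop) :
  is_downset M_PCL class_le (primes_below X).
Proof.
split=> [Y []//|Y Z [_ YX] MZ ZY]; split=> //.
exact: class_le_trans ZY YX.
Qed.

(** Prime classes behave like join-primes: lying below the whole set forces lying below one member.
    Surjectivity onto downsets depends on this. *)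
Lemma primes_below_loop_set (L : set loop_condition) (Y : h1_set -> Prop) :
  (forall l, L l -> is_cyclic l) ->
  primes_below (h1_class (loop_set L)) Y <->
  M_PCL Y /\ exists2 l, L l & class_le Y (h1_class (loop_set [set l])).
Proof.
move=> Lc; split=> [/primes_belowE[P [P_pr -> LP]]|[MY [l Ll Yl]]].
  split; first exact: M_PCL_Sigma.
  have [l Ll lP] := loop_set_implies_Sigma Lc P_pr LP.
  by exists l => //; apply/class_leE.
split=> //; apply: class_le_trans Yl _.
exact/class_leE/loop_set_implies_mem.
Qed.

Lemma primes_below_surj (D : (h1_set -> Prop) -> Prop) :
  is_downset M_PCL class_le D -> exists2 X, frakM_CL X & primes_below X = D.
Proof.
move=> [DM Ddown].
(* All prime conditions with class in [D]; a prime class below this set is below one member, hence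
   in [D]. *)
pose L : set loop_condition :=
  fun l => is_prime_cyclic l /\ D (h1_class (loop_set [set l])).
have Lc l : L l -> is_cyclic l by case=> /is_prime_cyclic_cyclic.
exists (h1_class (loop_set L)); first by exists L.
apply/funext => Y; apply/propext; rewrite (primes_below_loop_set _ Lc).
split=> [[MY [l [_ Dl] Yl]]|DY]; first exact: Ddown Dl MY Yl.
have [l l_pr Yl] := DM _ DY; split; first exact: DM.
exists l; first by split=> //; rewrite -Yl.
by rewrite Yl; apply/class_leE.
Qed.

Lemma frakM_CL_PCL : frakM_CL = frakM_PCL.
Proof.
apply/funext => X; apply/propext; split=> -[L Lc ->]; last first.
  by exists L => // l /Lc/is_prime_cyclic_cyclic.
(* All prime consequences of [L], which together imply [L] back. *)
pose L' : set loop_condition := fun l =>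
  is_prime_cyclic l /\ h1_implies (loop_set L) (loop_set [set l]).
exists L' => [l []//|]; apply/h1_class_eq; split.
  by apply: implies_loop_set => l [].
apply: implies_of_primes => // P P_pr LP; apply: loop_set_implies_mem.
by split=> //; exists P.
Qed.

Lemma M_CL_frakM_CL X : M_CL X -> frakM_CL X.
Proof. by move=> [l lc ->]; exists [set l] => // _ ->. Qed.

(** The decomposition of Σ_C uses only sets of prime divisors of the product of [C]; there are
    finitely many, and they generate. *)
Lemma primes_below_fg X :
  M_CL X -> is_fg_downset M_PCL class_le (primes_below X).
Proof.
move=> [l lc ->]; have [C lC] := is_cyclic_equiv_Sigma lc.
have -> : h1_class (loop_set [set l]) = h1_class (loop_set [set Sigma_ C]).
  exact/h1_class_eq.
pose N := length_prod C.
pose good (P : length_set) := [/\ prime_lengths P,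
  forall p, p \in lengths P -> p \in primes N &
  h1_implies (loop_set [set Sigma_ C]) (loop_set [set Sigma_ P])].
pose L : set loop_condition := fun l => exists2 P, good P & l = Sigma_ P.
have Lc l' : L l' -> is_cyclic l'.
  by move=> [P _ ->]; apply: is_cyclic_Sigma.
have CL : h1_equiv (loop_set [set Sigma_ C]) (loop_set L).
  split; first by apply: implies_loop_set => _ [P [_ _ CP] ->].
  move=> A AL; apply: satisfies_Sigma_primes => Q Q_pr QN CQ.
  by apply: loop_set_implies_mem AL; exists Q.
exists (fun Y => exists2 P, good P & Y = h1_class (loop_set [set Sigma_ P])).
split.
- pose W := fpowerset [fset p | p in primes N]%fset.
  (* Good sets are enumerated as elements of the powerset of the prime divisors of [N]. *)
  pose J := [set w : W | `[< exists2 P, good P & lengths P = val w >]]%SET.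
  have /choice[P PP] (j : 'I_#|J|) :
      exists P, good P /\ lengths P = val (enum_val j).
    have := enum_valP j; rewrite inE => /asboolP[P gP PJ].
    by exists P.
  exists #|J|, (fun j => h1_class (loop_set [set Sigma_ (P j)])) => Y.
  split=> [[Q gQ ->]|[j ->]]; last by exists (P j) => //; case: (PP j).
  have QW : lengths Q \in W.
    rewrite fpowersetE; apply/fsubsetP => q qQ.
    by have [_ QN _] := gQ; rewrite !inE QN.
  have QJ : [` QW]%fset \in J by rewrite inE; apply/asboolP; exists Q.
  exists (enum_rank_in QJ [` QW]%fset).
  have [_] := PP (enum_rank_in QJ [` QW]%fset).
  rewrite enum_rankK_in //= => E; congr (h1_class (loop_set [set Sigma_ _])).
  move: E; case: (P _) => S S0 S1; case: (Q) => S' S'0 S'1 /= E.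
  by subst S'; congr LengthSet; apply: bool_irrelevance.
- by move=> _ [P [P_pr _ _] ->]; apply: M_PCL_Sigma.
apply/funext => Y; apply/propext.
have -> : h1_class (loop_set [set Sigma_ C]) = h1_class (loop_set L).
  exact/h1_class_eq.
rewrite (primes_below_loop_set _ Lc).
split=> [[MY [_ [P gP ->] YP]]|[MY [_ [P gP ->] YP]]].
  by split=> //; exists (h1_class (loop_set [set Sigma_ P])) => //; exists P.
by split=> //; exists (Sigma_ P) => //; exists P.
Qed.

(** The finitely many generators are merged into one cyclic condition by taking products of
    lengths. *)
Lemma primes_below_fg_surj (D : (h1_set -> Prop) -> Prop) :
  is_fg_downset M_PCL class_le D -> exists2 X, M_CL X & primes_below X = D.
Proof.
move=> [G [[k [g gG]] GM ->]].
have /choice[P PP] i : exists P : length_set,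
    prime_lengths P /\ g i = h1_class (loop_set [set Sigma_ P]).
  have [|_ [P [P_pr ->]] Pg] := GM (g i); first by apply/gG; exists i.
  by exists P.
have [C CP] := Sigma_and_finite P.
pose L : set loop_condition := range (fun i => Sigma_ (P i)).
have Lc l : L l -> is_cyclic l by move=> [i _ <-]; apply: is_cyclic_Sigma.
exists (h1_class (loop_set [set Sigma_ C])).
  by exists (Sigma_ C) => //; apply: is_cyclic_Sigma.
have -> : h1_class (loop_set [set Sigma_ C]) = h1_class (loop_set L).
  apply/h1_class_eq; split=> A.
    move=> /CP AP; apply/satisfies_loop_set => _ [i _ <-].
    exact/satisfies_loop.
  move=> AL; apply/CP => i; apply: loop_set_implies_mem AL.
  by exists i.
apply/funext => Y; apply/propext; rewrite (primes_below_loop_set _ Lc).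
split=> [[MY [_ [i _ <-] YP]]|[MY [Z /gG[i ->] YP]]]; split=> //.
  by exists (g i); [apply/gG; exists i | rewrite (PP i).2].
by exists (Sigma_ (P i)); [exists i | rewrite -(PP i).2].
Qed.

Theorem corollary5p28 :
  frakM_CL = frakM_PCL /\
  order_isomorphic frakM_CL class_le
    (is_downset M_PCL class_le) (@included (h1_set -> Prop)) /\
  order_isomorphic M_CL class_le
    (is_fg_downset M_PCL class_le) (@included (h1_set -> Prop)).
Proof.
split; first exact: frakM_CL_PCL.
split; exists primes_below; split.
- by move=> X _; apply: is_downset_primes_below.
- exact: primes_below_inj.
- exact: primes_below_surj.
- exact: class_le_primes_below.
- exact: primes_below_fg.
- by move=> X X' /M_CL_frakM_CL MX /M_CL_frakM_CL MX'; apply: primes_below_inj.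
- exact: primes_below_fg_surj.
- move=> X X' /M_CL_frakM_CL MX /M_CL_frakM_CL MX'.
  exact: class_le_primes_below.
Qed.
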